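(* Consider the sum of the asymptotic variances $$\sum_{h=1}^{m}\sum_{f=1}^{p}\sigma_{h,f}^2,\qquad \sigma_{h,f}^2=\sum_{k=1}^{K}\sum_{i=1}^{n_k}\frac{(M^k_{(h,i)})^2(N_{k(i,f)})^2}{c_kp_{k_i}}-\sum_{k=1}^{K}\frac{((M^kN_k)_{(h,f)})^2}{c_k},$$ as a function of the sampling probabilities $p_{k_i}\ge 0$ ($k=1,\dots,K$, $i=1,\dots,n_k$), subject to $\sum_{i=1}^{n_k}p_{k_i}=1$ for each $k$, and of the sampling block sizes $c_k>0$ ($k=1,\dots,K$), subject to $\sum_{k=1}^{K}c_k=c$. This sum attains its minimum when $$p_{k_i}=\frac{\|M^{k(i)}\|_2\|N_{k(i)}\|_2}{\sum_{i'=1}^{n_k}\|M^{k(i')}\|_2\|N_{k(i')}\|_2},\qquad k=1,\dots,K,\ i=1,\dots,n_k,$$ and $$c_k=c\,\frac{\Big(\big(\sum_{i=1}^{n_k}\|M^{k(i)}\|_2\|N_{k(i)}\|_2\big)^2-\|M^kN_k\|_F^2\Big)^{1/2}}{\sum_{l=1}^{K}\Big(\big(\sum_{i=1}^{n_l}\|M^{l(i)}\|_2\|N_{l(i)}\|_2\big)^2-\|M^lN_l\|_F^2\Big)^{1/2}},\qquad k=1,\dots,K.$$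
   Context: $M\in\mathbb{R}^{m\times n}$ and $N\in\mathbb{R}^{n\times p}$ are partitioned conformally as $M=[M^1\ M^2\ \cdots\ M^K]$ with $M^k\in\mathbb{R}^{m\times n_k}$ and $N^T=[N_1^T\ N_2^T\ \cdots\ N_K^T]$ with $N_k\in\mathbb{R}^{n_k\times p}$, $\sum_{k=1}^K n_k=n$. $M^{k(i)}$ is the $i$-th column of $M^k$, $N_{k(i)}$ is the $i$-th row of $N_k$, $M^k_{(h,i)}$ and $N_{k(i,f)}$ are the $(h,i)$ entry of $M^k$ and the $(i,f)$ entry of $N_k$. $\|\cdot\|_2$ is the Euclidean norm, $\|\cdot\|_F$ the Frobenius norm. $c$ is a given positive integer (total number of samples). Terms of the form $0/0$ (zero outer-product entry with zero probability) are read as $0$. It is assumed that the displayed formulas for $p_{k_i}$ and $c_k$ are well defined and give $c_k>0$. Background on $\sigma^2_{h,f}$: it is the variance of the $(h,f)$ entry of the estimator $CD=\sum_{k=1}^{K}\sum_{t=1}^{c_k}\frac{M^{k(i_t)}N_{k(i_t)}}{c_kp_{k_{i_t}}}$ of $MN$, where within block $k$ the indices $i_1,\dots,i_{c_k}$ are drawn independently with replacement from $\{1,\dots,n_k\}$ with probabilities $\{p_{k_i}\}_{i=1}^{n_k}$, independently across blocks. *)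

(* Defs.v *)
From mathcomp Require Import all_boot all_order all_algebra.
From mathcomp Require Import reals constructive_ereal.
Set Implicit Arguments.
Unset Strict Implicit.
Unset Printing Implicit Defensive.
Import Order.TTheory GRing.Theory Num.Theory.
Local Open Scope ring_scope.

(* MathComp-Analysis equips matrices with the sup norm, hence these norms. *)
Definition norm2_col (R : realType) m (v : 'cV[R]_m) : R :=
  Num.sqrt (\sum_i v i 0 ^+ 2).

Definition norm2_row (R : realType) p (v : 'rV[R]_p) : R :=
  Num.sqrt (\sum_j v 0 j ^+ 2).

Definition normF (R : realType) m p (A : 'M[R]_(m, p)) : R :=
  Num.sqrt (\sum_i \sum_j A i j ^+ 2).

(* M = [M^1 ... M^K] and N^T = [N_1^T ... N_K^T] are matrices with column,
   resp. row, dimension \sum_k n_ k; their blocks M^k and N_k are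
   [submxrow M k] and [submxcol N k]. *)
Section BlockSampling.
Variables (R : realType) (K m p : nat) (n_ : 'I_K -> nat).
Variables (M : 'M[R]_(m, \sum_k n_ k)) (N : 'M[R]_(\sum_k n_ k, p)).

Definition blockM (k : 'I_K) : 'M[R]_(m, n_ k) := submxrow M k.
Definition blockN (k : 'I_K) : 'M[R]_(n_ k, p) := submxcol N k.

(* pr k i is p_{k_i}; s k is the (real) block size c_k. *)
Definition is_sampling_prob (pr : forall k : 'I_K, 'I_(n_ k) -> R) : Prop :=
  (forall k i, 0 <= pr k i) /\ (forall k, \sum_i pr k i = 1).

Definition is_block_sizes (c : nat) (s : 'I_K -> R) : Prop :=
  (forall k, 0 < s k) /\ \sum_k s k = c%:R.

(* The quotient is the extended-real one: x / 0 = +oo for x > 0, whereas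
   0 / 0 = 0 * +oo = 0. A vanishing probability is thus free of charge exactly
   where the corresponding outer-product entry vanishes. *)
Definition sigma2 (pr : forall k : 'I_K, 'I_(n_ k) -> R) (s : 'I_K -> R)
    (h : 'I_m) (f : 'I_p) : \bar R :=
  (\sum_k \sum_i ((blockM k h i ^+ 2 * blockN k i f ^+ 2)%:E
                    / (s k * pr k i)%:E)
   - (\sum_k ((blockM k *m blockN k) h f ^+ 2 / s k)%R)%:E)%E.

Definition total_variance (pr : forall k : 'I_K, 'I_(n_ k) -> R)
    (s : 'I_K -> R) : \bar R :=
  (\sum_h \sum_f sigma2 pr s h f)%E.

Definition norm_prod (k : 'I_K) (i : 'I_(n_ k)) : R :=
  norm2_col (col i (blockM k)) * norm2_row (row i (blockN k)).

Definition opt_prob (k : 'I_K) (i : 'I_(n_ k)) : R :=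
  norm_prod i / \sum_i' norm_prod (k := k) i'.

Definition block_weight (k : 'I_K) : R :=
  Num.sqrt ((\sum_i norm_prod (k := k) i) ^+ 2
            - normF (blockM k *m blockN k) ^+ 2).

Definition opt_size (c : nat) (k : 'I_K) : R :=
  c%:R * (block_weight k / \sum_l block_weight l).

End BlockSampling.

(* Main.v *)
(* Summed over [h] and [f], the variances give
   [\sum_k (\sum_i a_ki ^+ 2 / p_ki - `|M^k N_k|_F ^+ 2) / c_k] with
   [a_ki = |M^k(i)| * |N_k(i)|]. The inequality
   [\sum_i x_i ^+ 2 / y_i >= (\sum_i x_i) ^+ 2 / \sum_i y_i], an equality for
   [y] proportional to [x], is applied twice: inside each block with
   [x = a_k, y = p_k], which leaves [\sum_k w_k ^+ 2 / c_k] for the block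
   weights [w_k], and then across blocks with [x = w, y = c_k]. Probabilities
   that vanish where [a_ki] does not make the variance infinite. *)
Require Import Defs.
From mathcomp Require Import all_boot all_order all_algebra.
From mathcomp Require Import reals constructive_ereal.
From mathcomp Require Import ring.
Import Order.TTheory GRing.Theory Num.Theory.
Local Open Scope ring_scope.

Lemma sqr_sum_div_le (R : realFieldType) (I : finType) (x y : I -> R) :
  (forall i, 0 <= y i) -> (forall i, y i = 0 -> x i = 0) -> 0 < \sum_i y i ->
  (\sum_i x i) ^+ 2 / \sum_i y i <= \sum_i x i ^+ 2 / y i.
Proof.
move=> y_ge0 xy0 Y_gt0; set Y := \sum_i y i in Y_gt0 *; set X := \sum_i x i.
pose l := X / Y.
(* [x ^+ 2 / y >= 2 l x - l ^+ 2 y], the tangent at [x / y = l] *)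
have -> : X ^+ 2 / Y = \sum_i (2 * l * x i - l ^+ 2 * y i).
  rewrite sumrB -!mulr_sumr -/X -/Y /l.
  by field; rewrite gt_eqF.
apply: ler_sum => i _.
have [yi0|yi0] := eqVneq (y i) 0.
  by rewrite yi0 xy0 // expr0n /= !mulr0 mul0r subr0.
have yi_gt0 : 0 < y i by rewrite lt_neqAle eq_sym yi0 y_ge0.
rewrite -subr_ge0.
have -> : x i ^+ 2 / y i - (2 * l * x i - l ^+ 2 * y i)
          = (x i - l * y i) ^+ 2 / y i by field.
by rewrite divr_ge0 ?sqr_ge0 ?ltW.
Qed.

(** The equality case. The scale [t] lets it serve twice: [t = 1] for probabilities, [t = c] for
    block sizes. *)
Lemma sqr_sum_div_proportional (R : fieldType) (I : finType) (x : I -> R)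
    (t : R) : t != 0 -> \sum_i x i != 0 ->
  \sum_i x i ^+ 2 / (t * (x i / \sum_j x j)) = (\sum_i x i) ^+ 2 / t.
Proof.
move=> t0 X0; set X := \sum_j x j in X0 *.
have -> : X ^+ 2 / t = \sum_i X / t * x i.
  by rewrite -mulr_sumr -/X expr2 mulrAC.
apply: eq_bigr => i _.
(* Where [x i = 0] the denominator vanishes too, and the real quotient is [0] by convention. *)
have [->|xi0] := eqVneq (x i) 0; first by rewrite expr0n /= !mul0r mulr0.
by field; rewrite X0 t0 xi0.
Qed.

(** The inverse of [0] is [+oo] in [\bar R] but [0] in [R]; a zero numerator hides the
    difference. *)
Lemma EFin_div (R : realFieldType) (x y : R) :
  (y = 0 -> x = 0) -> (x%:E / y%:E)%E = (x / y)%:E.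
Proof.
move=> xy0; rewrite inver; case: eqP => [y0|_] //.
by rewrite xy0 // mul0e mul0r.
Qed.

Section Variance.
Context {R : realType} {K m p : nat} {n_ : 'I_K -> nat}.
Variables (M : 'M[R]_(m, \sum_k n_ k)) (N : 'M[R]_(\sum_k n_ k, p)).
Implicit Types (pr : forall k : 'I_K, 'I_(n_ k) -> R) (s : 'I_K -> R).

Lemma norm_prod_ge0 k (i : 'I_(n_ k)) : 0 <= norm_prod M N i.
Proof. by rewrite mulr_ge0 ?sqrtr_ge0. Qed.

(** The Frobenius norm of a column times a row factors into their Euclidean norms. *)
Lemma sqr_norm_prod k (i : 'I_(n_ k)) :
  norm_prod M N i ^+ 2
  = \sum_h \sum_f blockM M k h i ^+ 2 * blockN N k i f ^+ 2.
Proof.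
rewrite exprMn !sqr_sqrtr; try by apply: sumr_ge0 => j _; exact: sqr_ge0.
rewrite big_distrlr; apply: eq_bigr => h _; apply: eq_bigr => f _.
by rewrite !mxE.
Qed.

Lemma norm_prod_eq0 k (i : 'I_(n_ k)) h f :
  norm_prod M N i = 0 -> blockM M k h i ^+ 2 * blockN N k i f ^+ 2 = 0.
Proof.
move=> a0.
have t_ge0 h' f' : 0 <= blockM M k h' i ^+ 2 * blockN N k i f' ^+ 2.
  by rewrite mulr_ge0 ?sqr_ge0.
have := sqr_norm_prod k i; rewrite a0 expr0n => /esym/psumr_eq0P sum0.
have /psumr_eq0P -> // := sum0 (fun h' _ => sumr_ge0 _ (fun f' _ => t_ge0 h' f')) h isT.
Qed.

Lemma sqr_normF q r (A : 'M[R]_(q, r)) :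
  normF A ^+ 2 = \sum_i \sum_j A i j ^+ 2.
Proof.
by rewrite sqr_sqrtr //; do 2![apply: sumr_ge0 => ? _]; exact: sqr_ge0.
Qed.

(** Zero probabilities meet only zero numerators, so every quotient is real and the sums over [h]
    and [f] can be moved innermost. *)
Lemma total_variance_fin pr s : (forall k, 0 < s k) ->
  (forall k i, pr k i = 0 -> norm_prod M N i = 0) ->
  total_variance M N pr s
  = (\sum_k (\sum_i norm_prod M N i ^+ 2 / pr k i
             - normF (blockM M k *m blockN N k) ^+ 2) / s k)%:E.
Proof.
move=> s_gt0 pr0.
have sigma2E h f : sigma2 M N pr s h f =
    (\sum_k (\sum_i blockM M k h i ^+ 2 * blockN N k i f ^+ 2 / pr k i
             - (blockM M k *m blockN N k) h f ^+ 2) / s k)%:E.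
  rewrite /sigma2.
  under eq_bigr => k _.
    under eq_bigr => i _.
      rewrite EFin_div; last first.
        move=> /eqP; rewrite mulf_eq0 gt_eqF //= => /eqP /pr0.
        exact: norm_prod_eq0.
      over.
    rewrite sumEFin; over.
  rewrite sumEFin -EFinB -sumrB; congr (_ %:E); apply: eq_bigr => k _.
  rewrite mulrBl mulr_suml; congr (_ - _); apply: eq_bigr => i _.
  by rewrite invfM mulrA mulrAC.
rewrite /total_variance.
under eq_bigr => h _.
  under eq_bigr => f _ do rewrite sigma2E.
  rewrite sumEFin exchange_big /=; over.
rewrite sumEFin exchange_big; congr (_ %:E); apply: eq_bigr => k _ /=.
under eq_bigr => h _ do rewrite -mulr_suml sumrB.
rewrite -mulr_suml sumrB sqr_normF; congr ((_ - _) * _).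
under [LHS]eq_bigr => h _ do rewrite exchange_big /=.
rewrite exchange_big /=; apply: eq_bigr => i _.
rewrite sqr_norm_prod mulr_suml; apply: eq_bigr => h _.
by rewrite mulr_suml.
Qed.

(** A nonzero outer product has a nonzero entry, whose quotient is [+oo]; no summand is [-oo], so
    nothing cancels it. *)
Lemma total_variance_pinfty pr s k (i : 'I_(n_ k)) : (forall k, 0 < s k) ->
  (forall k i, 0 <= pr k i) -> pr k i = 0 -> norm_prod M N i != 0 ->
  total_variance M N pr s = +oo%E.
Proof.
move=> s_gt0 pr_ge0 pri0 ai0.
pose x l (j : 'I_(n_ l)) h f := blockM M l h j ^+ 2 * blockN N l j f ^+ 2.
have x_ge0 l j h f : 0 <= x l j h f by rewrite mulr_ge0 ?sqr_ge0.
pose t h f l j : \bar R := ((x l j h f)%:E / (s l * pr l j)%:E)%E.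
have t_ge0 h f l j : (0 <= t h f l j)%E.
  rewrite mule_ge0 ?lee_fin // inver; case: eqP => [_|_]; first exact: leey.
  by rewrite lee_fin invr_ge0 mulr_ge0 // ltW.
have ge0_NNy (z : \bar R) : (0 <= z)%E -> z != -oo%E by case: z.
have [h [f hf0]] : exists h f, x k i h f != 0.
  have : norm_prod M N i ^+ 2 != 0 by rewrite expf_neq0.
  rewrite sqr_norm_prod => /eqP sum_neq0.
  have [/existsP[h /existsP[f hf]]|] := boolP [exists h, exists f, x k i h f != 0].
    by exists h, f.
  move=> /existsPn all0; case: sum_neq0; apply: big1 => h _; apply: big1 => f _.
  by have /existsPn/(_ f)/negPn/eqP := all0 h.
(* A nonnegative sum minus a real number. *)
have sigma2_NNy h' f' : sigma2 M N pr s h' f' != -oo%E.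
  rewrite adde_eq_ninfty orbF; apply: ge0_NNy.
  by do 2![apply: sume_ge0 => ? _]; exact: t_ge0.
have sigma2_y : sigma2 M N pr s h f = +oo%E.
  rewrite /sigma2.
  have -> : (\sum_l \sum_j t h f l j = +oo)%E.
    apply/esum_eqyP => [l _|]; first by apply/ge0_NNy/sume_ge0 => j _.
    exists k; rewrite mem_index_enum; split=> //.
    apply/esum_eqyP => [j _|]; first exact/ge0_NNy.
    exists i; rewrite mem_index_enum; split=> //.
    rewrite /t pri0 mulr0 inve0 gt0_muley // lte_fin.
    by rewrite lt_neqAle eq_sym hf0 x_ge0.
  by rewrite addye.
apply/esum_eqyP => [h' _|].
  by apply/eqP => /esum_eqNyP[f' [_ _ /eqP]]; apply/negP.
exists h; rewrite mem_index_enum; split=> //.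
apply/esum_eqyP => [f' _|]; first exact: sigma2_NNy.
by exists f; rewrite mem_index_enum.
Qed.

End Variance.

Theorem theorem3 (R : realType) (K m p : nat) (n_ : 'I_K -> nat)
    (M : 'M[R]_(m, \sum_k n_ k)) (N : 'M[R]_(\sum_k n_ k, p)) (c : nat)
    (c_gt0 : (0 < c)%N)
    (prob_wd : forall k : 'I_K, \sum_(i < n_ k) norm_prod M N i != 0)
    (size_wd : \sum_(l < K) block_weight M N l != 0)
    (size_gt0 : forall k : 'I_K, 0 < opt_size M N c k) :
  [/\ is_sampling_prob (@opt_prob R K m p n_ M N),
      is_block_sizes c (opt_size M N c)
    & forall (pr : forall k : 'I_K, 'I_(n_ k) -> R) (s : 'I_K -> R),
        is_sampling_prob pr -> is_block_sizes c s ->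
        (total_variance M N (@opt_prob R K m p n_ M N) (opt_size M N c)
           <= total_variance M N pr s)%E].
Proof.
set a := @norm_prod R K m p n_ M N.
set w := block_weight M N; set W := \sum_l w l in size_wd *.
have c_gt0R : 0 < c%:R :> R by rewrite ltr0n.
have W_gt0 : 0 < W.
  by rewrite lt_neqAle eq_sym size_wd sumr_ge0 // => l _; exact: sqrtr_ge0.
have w_gt0 k : 0 < w k.
  by have := size_gt0 k; rewrite /opt_size pmulr_rgt0 // pmulr_lgt0 ?invr_gt0.
(* [Num.sqrt] is [0] on negative reals, so [0 < w k] forces a positive radicand. *)
have wE k : (\sum_i a k i) ^+ 2 - normF (blockM M k *m blockN N k) ^+ 2
            = w k ^+ 2.
  by rewrite [RHS]sqr_sqrtr // ltW // -sqrtr_gt0 w_gt0.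
have opt_probP : is_sampling_prob (@opt_prob R K m p n_ M N).
  split=> k => [i|]; last by rewrite -mulr_suml divff.
  by rewrite divr_ge0 ?norm_prod_ge0 // sumr_ge0 // => j _; exact: norm_prod_ge0.
have opt_sizeP : is_block_sizes c (opt_size M N c).
  by split=> //; rewrite -mulr_sumr -mulr_suml divff ?mulr1.
split=> // pr s [pr_ge0 pr1] [s_gt0 sc].
have [[k [i [pri0 ai0]]]|pr0] :
    (exists k i, pr k i = 0 /\ a k i != 0)
    \/ forall k i, pr k i = 0 -> a k i = 0.
  have [/existsP[k /existsP[i /andP[/eqP ? ?]]]|none] :=
      boolP [exists k, exists i, (pr k i == 0) && (a k i != 0)].
    by left; exists k, i.
  right=> k i pri0; move: none => /existsPn/(_ k)/existsPn/(_ i).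
  by rewrite pri0 eqxx /= => /negPn/eqP.
  by rewrite (total_variance_pinfty _ _ _ _ _ i s_gt0 pr_ge0 pri0 ai0) leey.
(* Both variances are now finite: [opt_prob] has a nonzero denominator, so it vanishes only with
   [a]. *)
rewrite !total_variance_fin //; last first.
  move=> k i /eqP; rewrite mulf_eq0 invr_eq0 (negPf (prob_wd k)) orbF.
  by move/eqP.
rewrite lee_fin.
(* The value at the claimed optimum, by the equality case inside each block and then across
   blocks. *)
have -> : \sum_k (\sum_i a k i ^+ 2 / opt_prob M N i
      - normF (blockM M k *m blockN N k) ^+ 2) / opt_size M N c k
    = W ^+ 2 / c%:R.
  rewrite -(@sqr_sum_div_proportional _ _ w) ?gt_eqF //.
  apply: eq_bigr => k _; congr (_ / _); rewrite -wE; congr (_ - _).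
  under eq_bigr => i _ do rewrite -[opt_prob M N i]mul1r.
  by rewrite sqr_sum_div_proportional ?oner_neq0 // divr1.
(* The middle term is the variance with optimal probabilities but the given sizes [s]. *)
apply: (@le_trans _ _ (\sum_k w k ^+ 2 / s k)).
  rewrite -sc; apply: sqr_sum_div_le => [k|k sk0|]; first exact: ltW.
    by have := s_gt0 k; rewrite sk0 ltxx.
  by rewrite sc.
apply: ler_sum => k _; rewrite ler_pM2r ?invr_gt0 // -wE lerD2r.
(* The denominator [1] is written as the total probability of block [k]. *)
rewrite -[leLHS]divr1 -(pr1 k).
by apply: sqr_sum_div_le => //; rewrite ?pr1 //; exact: pr0.
Qed.
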